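(* Let $m\ge 1$ be a fixed integer. If $E\|X\|_{\mathcal{B}}^{2}<\infty$, then $$E\,\|C_{m,n}-C_m\|_{\mathcal{B}\otimes\mathcal{B}}\to 0\qquad\text{as } n\to\infty .$$
   Context: $\mathcal{B}$ is a real separable Banach space with norm $\|\cdot\|_{\mathcal{B}}$. $X_1,X_2,\ldots$ are i.i.d. $\mathcal{B}$-valued random elements, identically distributed with $X$, with law $P$. $\mathcal{B}\otimes\mathcal{B}$ is the (completed) tensor product equipped with either the projective or the injective tensor norm, denoted $\|\cdot\|_{\mathcal{B}\otimes\mathcal{B}}$ (the result is asserted for each of the two choices). Expectations are Bochner expectations. For $1\le m\le n$ put $$\theta(m)=E\left(\frac{X_1+\cdots+X_m}{m}\right),$$ $$C_{m,n}=\frac{1}{\binom{n}{m}}\sum_{1\le i_1<\cdots<i_m\le n}\left(\frac{X_{i_1}+\cdots+X_{i_m}}{m}-\theta(m)\right)\otimes\left(\frac{X_{i_1}+\cdots+X_{i_m}}{m}-\theta(m)\right),$$ $$C_m=E\left\{\left(\frac{X_1+\cdots+X_m}{m}-\theta(m)\right)\otimes\left(\frac{X_1+\cdots+X_m}{m}-\theta(m)\right)\right\}.$$ *)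

(* Defs.v *)
From HB Require Import structures.
From mathcomp Require Export all_boot all_order all_algebra.
From mathcomp Require Export all_classical all_reals all_analysis.
Export numFieldNormedType.Exports.

Set Implicit Arguments.
Unset Strict Implicit.
Unset Printing Implicit Defensive.

Import Order.TTheory GRing.Theory Num.Theory.

Local Open Scope classical_set_scope.
Local Open Scope ring_scope.

Definition separable (T : topologicalType) : Prop :=
  exists2 D : set T, countable D & dense D.

(* [V] with its Borel sigma-algebra *)
Notation borelType V := (g_sigma_algebraType (@open V)).

Section Tensor.
Context {R : realType} {B : normedModType R}.

(* A formal tensor [:: (x1, y1); ..; (xk, yk)] stands for the element
   x1 (x) y1 + .. + xk (x) yk of the algebraic tensor product of B with itself;
   every element of the latter has this form.  As usual, an elementary tensor
   x (x) y is viewed as the linear functional b |-> b x y on bilinear forms, so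
   that two formal tensors represent the same element of the algebraic tensor
   product iff they agree on all (not necessarily bounded) bilinear forms. *)
Implicit Types s t : seq (B * B).

Definition tensor_eq s t : Prop :=
  forall b : {biscalar B},
    \sum_(p <- s) b p.1 p.2 = \sum_(p <- t) b p.1 p.2.

Definition projective_norm s : R :=
  inf [set r | exists2 t, tensor_eq s t &
                 r = \sum_(p <- t) `|p.1| * `|p.2|].

Definition dual_unit_ball : set {scalar B} :=
  [set f | forall x, `|f x| <= `|x|].

Definition injective_norm s : R :=
  sup [set r | exists f g : {scalar B},
         [/\ dual_unit_ball f, dual_unit_ball g &
             r = `|\sum_(p <- s) f p.1 * g p.2| ]].

Variant tensor_norm_kind := Projective | Injective.

Definition tensor_norm (k : tensor_norm_kind) : seq (B * B) -> R :=
  match k with Projective => projective_norm | Injective => injective_norm end.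

(* The Banach space T, together with the bilinear map tau (x, y) |-> x (x) y, is
   a completion of the algebraic tensor product of B with itself for the given
   tensor norm, i.e. the canonical map from the algebraic tensor product to T is
   isometric (hence well defined and injective) with dense range.  This
   determines (T, tau) up to a unique isometric isomorphism. *)
Definition is_completed_tensor_product (k : tensor_norm_kind)
    (T : completeNormedModType R) (tau : {bilinear B -> B -> T}) : Prop :=
  (forall s, `|\sum_(p <- s) tau p.1 p.2| = tensor_norm k s) /\
  dense (range (fun s => \sum_(p <- s) tau p.1 p.2)).

End Tensor.

Section Bochner.
Context {R : realType} {d : measure_display} {Omega : measurableType d}.
Variables (P : probability Omega R) (V : normedModType R).

Definition simple_function (s : Omega -> V) : Prop :=
  finite_set (range s) /\ forall v, measurable (s @^-1` [set v]).

Definition simple_expectation (s : Omega -> V) : V :=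
  \sum_(v \in range s) fine (P (s @^-1` [set v])) *: v.

Definition is_bochner_expectation (f : Omega -> V) (e : V) : Prop :=
  exists s : nat -> Omega -> V,
    [/\ forall k, simple_function (s k),
        {ae P, forall w, s k w @[k --> \oo] --> f w},
        'E_P[fun w => `|f w - s k w|%R]%E @[k --> \oo] --> 0%E &
        simple_expectation (s k) @[k --> \oo] --> e].

(* The value is 0 when f is not Bochner integrable. *)
Definition bochner_expectation (f : Omega -> V) : V :=
  xget 0 [set e | is_bochner_expectation f e].

End Bochner.

Section RandomElements.
Context {R : realType} {d : measure_display} {Omega : measurableType d}.
Context {P : probability Omega R}.
Context {d' : measure_display} {E : measurableType d'}.

Definition mutually_independent (X : nat -> {RV P >-> E}) : Prop :=
  forall (I : seq nat) (A : nat -> set E), uniq I ->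
    (forall i, measurable (A i)) ->
    P (\bigcap_(i in [set` I]) (X i @^-1` A i)) =
      (\prod_(i <- I) P (X i @^-1` A i))%E.

(* Laws are compared on measurable sets only: [distribution P X] is a total
   function on [set E]. *)
Definition same_law (X Y : {RV P >-> E}) : Prop :=
  forall A, measurable A -> distribution P X A = distribution P Y A.

Definition iid_as (X : nat -> {RV P >-> E}) (Y : {RV P >-> E}) : Prop :=
  mutually_independent X /\ forall i, same_law (X i) Y.

End RandomElements.

Section Covariance.
Context {R : realType} {d : measure_display} {Omega : measurableType d}.
Context {P : probability Omega R} {B : normedModType R}.
Variables (m : nat) (X : nat -> {RV P >-> borelType B}).

(* The sequence is indexed from 0: X_1, X_2, .. are [X 0], [X 1], ..; the list
   [I] holds the m indices being averaged. *)
Definition mean (I : seq nat) (w : Omega) : B :=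
  m%:R^-1 *: \sum_(i <- I) (X i w : B).

Definition theta : B := bochner_expectation P (mean (iota 0 m)).

Variables (T : completeNormedModType R) (tau : {bilinear B -> B -> T}).

Definition centered_square (I : seq nat) (w : Omega) : T :=
  tau (mean I w - theta) (mean I w - theta).

Definition sample_cov (n : nat) (w : Omega) : T :=
  'C(n, m)%:R^-1 *:
    \sum_(i : m.-tuple 'I_n | sorted ltn (map val i))
      centered_square (map val i) w.

Definition cov : T := bochner_expectation P (centered_square (iota 0 m)).

End Covariance.

(* Main.v *)
Require Import Defs.
From mathcomp Require Import lra ring measurable_realfun.

(** Why the theorem holds.  Write H(I) for the centered square of the mean over
    the index list I.  The sample covariance is the average of H(I) over all
    m-subsets I of the first n indices, so the claim is a law of large numbers
    in mean for a U-statistic with values in the tensor product.  It is proved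
    by replacing the observations by observations with finitely many values.

    Quantization.  Let q_k send a point of the separable space B to a closest
    point among the first k + 1 terms of a dense sequence starting at 0.  Then
    |x - q_k(x)| <= |x| tends to 0, so E|X - q_k(X)|^2 tends to 0 by dominated
    convergence (quantize_mean_square_cvg).  Let H_k(I) be H(I) with every X_i
    replaced by q_k(X_i).  Both tensor norms of an elementary tensor x (x) y are
    at most |x||y| (tensor_norm_elementary_le), and Young's inequality bounds
    |H(I) - H_k(I)| by an average over i in I of functions of the single X_i
    (norm_squared_meanB).  Hence E|H(I) - H_k(I)| is small uniformly in I, and
    only the common marginal law enters.

    Bochner expectations.  The functions H_k(I) are simple and tend to H(I)
    pointwise and in mean, so the covariance exists as a Bochner expectation and
    is close to the simple expectation of H_k(I) (norm_bochner_expectationB).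

    Finite alphabet.  H_k(I) is a function of the word of labels of the X_i with
    i in I, and there are finitely many words b.  The average of H_k(I) is
    therefore the sum over b of the frequency of b times the value of the
    quantized kernel at b, and what remains is a weak law for the frequency of
    each word.  Words on disjoint index sets are independent, and a proportion
    of at most m^2 / n of the m-subsets meets a given one
    (overlapping_sorted_tuples_le), so the variance of the frequency is at most
    m^2 / n (word_frequency_sqr_le).

    All estimates are pointwise bounds by measurable real functions, so
    measurability enters only through finite labels and real-valued
    distances. *)

Set Implicit Arguments.
Unset Strict Implicit.
Unset Printing Implicit Defensive.

Import Order.TTheory GRing.Theory Num.Theory.

(** * Overlapping index tuples *)

(** The sets that avoid i are the m-subsets of the remaining n - 1 points; the
    absorption identity for binomials then gives the proportion m / n. *)
Lemma card_draws_mem (n m : nat) (i : 'I_n) :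
  (#|[set A : {set 'I_n} | (i \in A) && (#|A| == m)]| * n = m * 'C(n, m))%N.
Proof.
case: n i => [[]//|n] i.
have split_mem : (#|[set A : {set 'I_n.+1} | (i \in A) && (#|A| == m)]|
    + 'C(n, m) = 'C(n.+1, m))%N.
  rewrite -[in RHS](card_ord n.+1) -card_draws.
  rewrite -[RHS](cardsID [set A : {set 'I_n.+1} | i \in A]); congr addn.
    by apply: eq_card => A; rewrite !inE andbC.
  rewrite -[n in LHS](card_ord n) -(_ : #|[set~ i]| = #|'I_n|); last first.
    by rewrite cardsC1 !card_ord.
  rewrite -cards_draws; apply: eq_card => A.
  by rewrite !inE -finset.setCS finset.setCK finset.sub1set inE.
case: m split_mem => [|m] split_mem; last first.
  by rewrite mulnC -mul_bin_diag; congr muln; apply/eqP;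
     rewrite -(eqn_add2r 'C(n, m.+1)) split_mem binS addnC.
by rewrite !bin0 in split_mem *; case: split_mem; rewrite addn1 => -[->].
Qed.

Lemma sorted_tuples_mem_le (n m : nat) (i : 'I_n) :
  (#|[set t : m.-tuple 'I_n | sorted ltn (map val t) && (i \in t)]| * n
     <= m * 'C(n, m))%N.
Proof.
rewrite -(card_draws_mem m i) leq_mul2r; apply/orP; right.
set S := finset _.
rewrite -(card_in_imset (f := fun t : m.-tuple 'I_n => [set j in t]) (D := S)).
  apply/subset_leq_card/fintype.subsetP => _ /imsetP[t + ->].
  rewrite !inE => /andP[st ->].
  rewrite cardsE (card_uniqP _) ?size_tuple ?eqxx//.
  by rewrite -(map_inj_uniq val_inj); exact: (sorted_uniq ltn_trans ltnn).
move=> t u; rewrite !inE => /andP[st _] /andP[su _] /setP tu.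
apply/val_inj/(inj_map val_inj)/(irr_sorted_eq ltn_trans ltnn st su) => k.
apply/mapP/mapP => -[j jt ->]; exists j => //; have := tu j; rewrite !inE.
  by rewrite jt => <-.
by rewrite jt.
Qed.

(** Two random size-m subsets of n indices rarely meet: each of the m indices of
    t lies in a proportion m / n of the subsets. *)
Lemma overlapping_sorted_tuples_le (n m : nat) (t : m.-tuple 'I_n) :
  (#|[set u : m.-tuple 'I_n | sorted ltn (map val u) && has (mem t) u]| * n
     <= m ^ 2 * 'C(n, m))%N.
Proof.
set S := fun i : 'I_n =>
  [set u : m.-tuple 'I_n | sorted ltn (map val u) && (i \in u)].
apply: (@leq_trans ((\sum_(i <- t) #|S i|) * n)).
  rewrite leq_mul2r; apply/orP; right.
  suff union (s : seq 'I_n) : (#|[set u : m.-tuple 'I_n |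
      sorted ltn (map val u) && has (mem s) u]| <= \sum_(i <- s) #|S i|)%N.
    exact: union.
  elim: s => [|i s ih].
    rewrite big_nil leqn0 cards_eq0; apply/eqP/finset.setP => u.
    by rewrite !inE; apply/negbTE/negP => /andP[_ /hasP[j _]].
  rewrite big_cons; apply: leq_trans (leq_add (leqnn _) ih).
  apply: leq_trans (leq_card_setU _ _).
  apply/subset_leq_card/fintype.subsetP => u; rewrite !inE => /andP[-> /=].
  case/hasP=> j ju; rewrite inE => /predU1P[<-|js]; first by rewrite ju.
  by apply/orP; right; apply/hasP; exists j.
rewrite big_distrl/=.
apply: (@leq_trans (\sum_(i <- t) m * 'C(n, m))).
  by apply: leq_sum => i _; exact: sorted_tuples_mem_le.
rewrite big_const_seq count_predT size_tuple iter_addn_0.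
by rewrite expnS expn1 mulnC mulnA.
Qed.

Local Open Scope classical_set_scope.
Local Open Scope ring_scope.

(** * Expectations of nonnegative functions *)

Lemma measurable_sum_cond {R : realType} {d : measure_display}
    {Omega : measurableType d} (I : Type) (s : seq I) (Q : pred I)
    (f : I -> Omega -> R) : (forall i, measurable_fun setT (f i)) ->
  measurable_fun setT (fun w => \sum_(i <- s | Q i) f i w).
Proof.
move=> mf; under eq_fun do rewrite big_mkcond.
by apply: measurable_sum => i; case: (Q i).
Qed.

Section NonnegativeExpectation.
Context {R : realType} {d : measure_display} {Omega : measurableType d}.
Variable P : probability Omega R.
Implicit Types f g : Omega -> R.

(** The integral of a nonnegative function is the supremum of the integrals of
    the simple functions below it, so it is monotone on all functions: the norm
    of a random element can be bounded before anything is known about its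
    measurability. *)
Lemma ge0_expectation_mono f g : (forall w, 0 <= f w) ->
  (forall w, f w <= g w) -> ('E_P[f] <= 'E_P[g])%E.
Proof.
move=> f0 fg; rewrite unlock !ge0_integralTE; last 2 first.
- by move=> w; rewrite lee_fin (le_trans (f0 w)).
- by move=> w; rewrite lee_fin.
apply: ereal_sup_le => _ [h hf <-]; exists h => // w.
by rewrite (le_trans (hf w))// lee_fin.
Qed.

Lemma ge0_expectationD f g :
    (forall w, 0 <= f w) -> measurable_fun setT f ->
    (forall w, 0 <= g w) -> measurable_fun setT g ->
  ('E_P[fun w => (f w + g w)%R] = 'E_P[f] + 'E_P[g])%E.
Proof.
move=> f0 mf g0 mg; rewrite unlock -ge0_integralD//.
- by move=> w _; rewrite lee_fin.
- exact/measurable_EFinP.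
- by move=> w _; rewrite lee_fin.
- exact/measurable_EFinP.
Qed.

Lemma ge0_expectationZ (c : R) f : 0 <= c ->
    (forall w, 0 <= f w) -> measurable_fun setT f ->
  ('E_P[fun w => (c * f w)%R] = c%:E * 'E_P[f])%E.
Proof.
move=> c0 f0 mf; rewrite unlock -ge0_integralZl_EFin//.
- by move=> w _; rewrite lee_fin.
- exact/measurable_EFinP.
Qed.

Lemma ge0_expectation_sum (I : Type) (s : seq I) (Q : pred I)
    (f : I -> Omega -> R) :
    (forall i w, 0 <= f i w) -> (forall i, measurable_fun setT (f i)) ->
  ('E_P[fun w => (\sum_(i <- s | Q i) f i w)%R] =
   \sum_(i <- s | Q i) 'E_P[f i])%E.
Proof.
move=> f0 mf; elim: s => [|i s ih].
  by under eq_fun do rewrite big_nil; rewrite big_nil expectation_cst.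
rewrite big_cons -ih; under eq_fun do rewrite big_cons.
case: (Q i) => //; rewrite ge0_expectationD//.
- by move=> w; apply: sumr_ge0.
- exact: measurable_sum_cond.
Qed.

End NonnegativeExpectation.

(** * Functions that factor through a finite label *)

Definition measurable_label {d : measure_display} {Omega : measurableType d}
    {J : finType} (lab : Omega -> J) : Prop :=
  forall j, measurable (lab @^-1` [set j]).

Section Label.
Context {R : realType} {d : measure_display} {Omega : measurableType d}.
Variable P : probability Omega R.
Context {J : finType}.
Variables (lab : Omega -> J) (mlab : measurable_label lab).

Let preimage_label (Q : set J) :
  lab @^-1` Q = \bigcup_(j in Q) (lab @^-1` [set j]).
Proof.
by apply/seteqP; split => [w Qw|w [j Qj /= ->]//]; exists (lab w).
Qed.

Lemma measurable_label_preimage (Q : set J) : measurable (lab @^-1` Q).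
Proof. by rewrite preimage_label; apply: fin_bigcup_measurable. Qed.

Lemma label_preimageE (Q : set J) :
  fine (P (lab @^-1` Q)) = \sum_(j | j \in Q) fine (P (lab @^-1` [set j])).
Proof.
rewrite preimage_label measure_fin_bigcup//; last 2 first.
- exact: finite_finset.
- by move=> i j _ _ [w [/= <- <-]].
rewrite -[X in (\sum_(j \in X) _)%E](set_mem_set Q).
rewrite -(@bigfs _ _ _ _ (index_enum J)) ?index_enum_uniq//.
  by apply/esym/sum_fine => j _; exact: fin_num_measure.
by move=> j _; rewrite mem_index_enum.
Qed.

Lemma measurable_fun_label d' (E : measurableType d') (u : J -> E) :
  measurable_fun setT (u \o lab).
Proof.
move=> _ A _; rewrite setTI comp_preimage; exact: measurable_label_preimage.
Qed.

Lemma expectation_label (u : J -> R) : (forall j, 0 <= u j) ->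
  ('E_P[u \o lab] = (\sum_j fine (P (lab @^-1` [set j])) * u j)%R%:E)%E.
Proof.
move=> u0.
have -> : u \o lab = fun w => \sum_j u j * \1_(lab @^-1` [set j]) w.
  apply/funext => w /=; rewrite (bigD1 (lab w))//= indicE mem_set// mulr1.
  rewrite big1 ?addr0// => j jw; rewrite indicE memNset ?mulr0//= => e.
  by rewrite e eqxx in jw.
rewrite ge0_expectation_sum//; last 2 first.
- by move=> j w; rewrite mulr_ge0.
- by move=> j; apply: measurable_funM => //.
rewrite -sumEFin; apply: eq_bigr => j _.
rewrite ge0_expectationZ//.
by rewrite expectation_indic// EFinM fineK ?fin_num_measure// muleC.
Qed.

Context {V : normedModType R}.

Lemma simple_function_label (u : J -> V) : simple_function (u \o lab).
Proof.
split=> [|v].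
  apply: (@sub_finite_set _ _ [set u j | j in setT]); last exact: finite_image.
  by move=> _ [w _ <-]; exists (lab w).
exact: measurable_label_preimage (u @^-1` [set v]).
Qed.

(** The defining sum of a simple expectation runs over the range of the
    function; grouping the labels by their value turns it into a sum over any
    finer finite label.  On a common label of two simple functions their
    expectations become comparable term by term. *)
Lemma simple_expectation_label (u : J -> V) :
  simple_expectation P (u \o lab) = \sum_j fine (P (lab @^-1` [set j])) *: u j.
Proof.
rewrite /simple_expectation.
pose r := undup [seq u j | j : J].
rewrite (@fsbig_fwiden V V 0 +%R r); last 3 first.
- by move=> _ [w _ <-] /=; rewrite mem_undup; apply/mapP; exists (lab w);
    rewrite ?mem_enum.
- exact: undup_uniq.
- move=> v /= [_ vr]; rewrite (_ : _ @^-1` _ = set0) ?measure0 ?scale0r//.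
  by apply/seteqP; split => // w /= e; apply: vr; exists w.
transitivity (\sum_(v <- r) \sum_j
    if v == u j then fine (P (lab @^-1` [set j])) *: u j else 0).
  apply: eq_bigr => v _.
  rewrite (label_preimageE (u @^-1` [set v])) scaler_suml -big_mkcond.
  apply: eq_big => [j|j]; last by rewrite inE/= => ->.
  by apply/idP/eqP; rewrite inE/= => ->.
rewrite exchange_big/=; apply: eq_bigr => j _.
rewrite (bigD1_seq (u j)) ?undup_uniq//=; last first.
  by rewrite mem_undup; apply/mapP; exists j; rewrite ?mem_enum.
by rewrite eqxx big1 ?addr0// => v /negbTE ->.
Qed.

End Label.

Section ExtendedLimits.
Context {R : realType}.
Implicit Types u : nat -> \bar R.

Lemma ge0_cvge0P u : (forall k, (0 <= u k)%E) ->
  (u @ \oo --> 0%E) <->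
  (forall e : R, 0 < e -> \forall k \near \oo, (u k <= e%:E)%E).
Proof.
move=> u0; split=> [uE e e0|uE].
  have /uE : nbhs (0%E : \bar R) [set x | (x < e%:E)%E].
    apply: open_nbhs_nbhs; split; first exact: open_ereal_lt_ereal.
    by rewrite /= lte_fin.
  move=> ue; near=> k; apply: ltW; near: k; exact: ue.
have ufin e k : (u k <= e%:E)%E -> u k \is a fin_num.
  move=> ue; rewrite ge0_fin_numE//; exact: le_lt_trans ue (ltry _).
apply/fine_cvgP; split; first by apply: filterS (uE 1 ltr01) => k /ufin.
apply/cvgr0Pnorm_le => e e0; apply: filterS (uE e e0) => k ue /=.
by rewrite ger0_norm ?fine_ge0// -lee_fin fineK// (ufin e).
Unshelve. all: by end_near. Qed.

End ExtendedLimits.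

(** * Bochner expectations as limits of simple expectations *)

Section BochnerApproximation.
Context {R : realType} {d : measure_display} {Omega : measurableType d}.
Variable P : probability Omega R.

Section Simple.
Context {V : normedModType R}.
Implicit Types s t : Omega -> V.

Lemma simple_function_factor s : simple_function s ->
  exists (J : finType) (lab : Omega -> J) (u : J -> V),
    measurable_label lab /\ s = u \o lab.
Proof.
move=> [/finite_seqP[r sr] ms].
have sw w : s w \in r by have : range s (s w) by []; rewrite sr.
exists (seq_sub r), (fun w => SeqSub (sw w)), val; split => // a.
rewrite (_ : _ @^-1` _ = s @^-1` [set val a])//.
by apply/seteqP; split => w /= => [<-//|e]; apply: val_inj.
Qed.

(** A common label turns statements about two simple functions into statements
    about finite sums. *)
Lemma simple_function_factor2 s t : simple_function s -> simple_function t ->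
  exists (J : finType) (lab : Omega -> J) (u v : J -> V),
    [/\ measurable_label lab, s = u \o lab & t = v \o lab].
Proof.
move=> /simple_function_factor[J [lab [u [mlab ->]]]].
move=> /simple_function_factor[J' [lab' [v [mlab' ->]]]].
exists (J * J')%type, (fun w => (lab w, lab' w)), (u \o fst), (v \o snd).
split => // -[j j']; rewrite (_ : _ @^-1` _ =
    lab @^-1` [set j] `&` lab' @^-1` [set j']); first exact: measurableI.
by apply/seteqP; split => w /= => [[-> ->]|[-> ->]].
Qed.

Lemma measurable_simple_dist s t : simple_function s -> simple_function t ->
  measurable_fun setT (fun w => `|s w - t w|).
Proof.
move=> ss st.
have [J [lab [u [v [mlab -> ->]]]]] := simple_function_factor2 ss st.
exact: (measurable_fun_label mlab (fun j => `|u j - v j|)).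
Qed.

Lemma norm_simple_expectationB s t : simple_function s -> simple_function t ->
  (`|simple_expectation P s - simple_expectation P t|%:E <=
   'E_P[fun w => `|s w - t w|%R])%E.
Proof.
move=> ss st.
have [J [lab [u [v [mlab -> ->]]]]] := simple_function_factor2 ss st.
rewrite !simple_expectation_label//.
rewrite (expectation_label P mlab (u := fun j => `|u j - v j|))// lee_fin.
rewrite -sumrB (le_trans (ler_norm_sum _ _ _))//; apply: ler_sum => j _.
by rewrite -scalerBr normrZ ger0_norm// fine_ge0.
Qed.

(** The distance is a limit of distances between simple functions, which are
    measurable because they factor through a finite label; measurability of
    the difference of two vector-valued functions does not enter. *)
Lemma measurable_limit_dist (f s : Omega -> V) (t : nat -> Omega -> V) :
    (forall k, simple_function (t k)) -> (forall w, t ^~ w @ \oo --> f w) ->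
    simple_function s ->
  measurable_fun setT (fun w => `|f w - s w|).
Proof.
move=> st tf ss.
apply: (@measurable_fun_cvg _ _ _ _ (fun k w => `|t k w - s w|)) => [k|w _].
  exact: measurable_simple_dist.
apply: cvg_norm; apply: cvgB; [exact: tf|exact: cvg_cst].
Qed.

End Simple.

Context {V : completeNormedModType R}.
Variables (f : Omega -> V) (t : nat -> Omega -> V).
Hypothesis t_simple : forall k, simple_function (t k).
Hypothesis t_cvg : forall w, t ^~ w @ \oo --> f w.
Hypothesis t_mean : 'E_P[fun w => `|f w - t k w|%R]%E @[k --> \oo] --> 0%E.

Let simple_expectation_dist s k : simple_function s ->
  (`|simple_expectation P s - simple_expectation P (t k)|%:E <=
   'E_P[fun w => `|f w - s w|%R] + 'E_P[fun w => `|f w - t k w|%R])%E.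
Proof.
move=> ss; apply: le_trans (norm_simple_expectationB ss (t_simple k)) _.
rewrite -ge0_expectationD//.
- apply: ge0_expectation_mono => // w.
  rewrite (_ : s w - t k w = (f w - t k w) - (f w - s w)).
    by rewrite [leRHS]addrC ler_normB.
  by rewrite opprB [RHS]addrC addrA subrK.
- exact: measurable_limit_dist t_simple t_cvg ss.
- exact: measurable_limit_dist t_simple t_cvg _.
Qed.

Let small_dist e : 0 < e ->
  \forall k \near \oo, ('E_P[fun w => `|f w - t k w|%R] <= e%:E)%E.
Proof.
move=> e0; move/ge0_cvge0P : t_mean; apply => // k; exact: expectation_ge0.
Qed.

Let bochner_expectation_exists : exists e, is_bochner_expectation P f e.
Proof.
suff [e te] : exists e : V, simple_expectation P (t k) @[k --> \oo] --> e.
  exists e, t; split => //; exact/aeW.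
apply/cvg_ex; apply: cauchy_cvg; apply: cauchy_exP => e e0.
have e3 : 0 < e / 3 by rewrite divr_gt0.
have [K _ tK] := small_dist e3.
exists (simple_expectation P (t K)); exists K => // l /= Kl.
rewrite -ball_normE /= -lte_fin.
apply: le_lt_trans (simple_expectation_dist l (t_simple K)) _.
apply: le_lt_trans (leeD (tK K (leqnn K)) (tK l Kl)) _.
by rewrite -EFinD lte_fin; lra.
Qed.

(** An unspecified approximating sequence witnesses the Bochner expectation of
    f, but its members are as close to the t k in mean as to f. *)
Lemma norm_bochner_expectationB k :
  (`|bochner_expectation P f - simple_expectation P (t k)|%:E <=
   'E_P[fun w => `|f w - t k w|%R])%E.
Proof.
have : is_bochner_expectation P f (bochner_expectation P f).
  by case: bochner_expectation_exists => e fe; rewrite /bochner_expectation;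
     case: xgetP => // /(_ e).
set b := bochner_expectation P f => -[s [ss _ sf sb]].
apply/lee_addgt0Pr => e e0.
have e2 : 0 < e / 2 by rewrite divr_gt0.
have near_f : \forall j \near \oo,
    ('E_P[fun w => `|f w - s j w|%R] <= (e / 2)%:E)%E.
  move/ge0_cvge0P : sf; apply => // j; exact: expectation_ge0.
have near_b : \forall j \near \oo, `|b - simple_expectation P (s j)| <= e / 2.
  by move/cvgrPdist_le : sb; apply.
have [j [fj bj]] := filter_ex (filterI near_f near_b).
apply: (@le_trans _ _ (`|b - simple_expectation P (s j)|%:E +
    `|simple_expectation P (s j) - simple_expectation P (t k)|%:E)%E).
  by rewrite -EFinD lee_fin (le_trans _ (ler_normD _ _))// addrA subrK.
rewrite -lee_fin in bj.
apply: le_trans (leeD bj (simple_expectation_dist k (ss j))) _.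
rewrite addeA addeC leeD2l//.
apply: le_trans (leeD2l _ fj) _.
by rewrite -EFinD lee_fin; lra.
Qed.

End BochnerApproximation.

(** * Frequencies in a weakly dependent family of events *)

Section Frequency.
Context {R : realType} {d : measure_display} {Omega : measurableType d}.
Variable P : probability Omega R.
Context {I : finType}.
Variables (S : {set I}) (D : I -> set Omega) (dep : rel I) (p c : R).
Hypothesis S_gt0 : (0 < #|S|)%N.
Hypothesis mD : forall i, measurable (D i).
Hypothesis PD : forall i, i \in S -> P (D i) = p%:E.
Hypothesis PDD : forall i j, i \in S -> j \in S -> ~~ dep i j ->
  P (D i `&` D j) = (p ^+ 2)%:E.
Hypothesis dep_le : forall i, i \in S ->
  #|[set j in S | dep i j]%SET|%:R <= c * #|S|%:R.

Definition frequency (w : Omega) : R :=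
  #|S|%:R^-1 * \sum_(i in S) \1_(D i) w.

Let N0 : 0 < #|S|%:R :> R. Proof. by rewrite ltr0n. Qed.

Let N_ge0 : 0 <= #|S|%:R^-1 :> R. Proof. by rewrite invr_ge0. Qed.

Let p_ge0 : 0 <= p.
Proof.
have /card_gt0P[i iS] := S_gt0.
by rewrite -lee_fin -(PD iS) measure_ge0.
Qed.

Let mfrequency : measurable_fun setT frequency.
Proof.
apply: measurable_funM => //; apply: measurable_sum_cond => i.
exact: measurable_indic.
Qed.

Let frequency_ge0 w : 0 <= frequency w.
Proof. by rewrite mulr_ge0// sumr_ge0. Qed.

Let expectation_frequency : ('E_P[frequency] = p%:E)%E.
Proof.
rewrite ge0_expectationZ//; last 2 first.
- by move=> w; apply: sumr_ge0.
- by apply: measurable_sum_cond => i; exact: measurable_indic.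
rewrite ge0_expectation_sum//; last by move=> i; exact: measurable_indic.
under eq_bigr => i iS do rewrite expectation_indic// PD//.
rewrite sumEFin sumr_const -EFinM -[p *+ _]mulr_natl mulrA mulVf ?mul1r//.
exact: lt0r_neq0.
Qed.

Let sum_PDD i : i \in S ->
  (\sum_(j in S) P (D i `&` D j) <= (#|S|%:R * (p ^+ 2 + c))%:E)%E.
Proof.
move=> iS; apply: (@le_trans _ _ (\sum_(j in S) (p ^+ 2 + (dep i j)%:R)%:E)%E).
  apply: lee_sum => j jS; case: (boolP (dep i j)) => [ij|/(PDD iS jS)->].
    rewrite (le_trans (probability_le1 _ _))//; first exact: measurableI.
    by rewrite lee_fin lerDr sqr_ge0.
  by rewrite addr0.
rewrite sumEFin lee_fin big_split/= sumr_const mulrDr -[p ^+ 2 *+ _]mulr_natl.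
rewrite lerD2l mulrC (le_trans _ (dep_le iS))// -natr_sum ler_nat.
by rewrite -sum1dep_card big_mkcondr/=; apply: leq_sum => j _; case: (dep i j).
Qed.

Let expectation_frequency2 :
  ('E_P[fun w => (frequency w ^+ 2)%R] <= (p ^+ 2 + c)%:E)%E.
Proof.
have -> : (fun w => frequency w ^+ 2) = fun w => (#|S|%:R^-1 ^+ 2) *
    \sum_(i in S) \sum_(j in S) \1_(D i `&` D j) w.
  apply/funext => w; rewrite exprMn; congr (_ * _).
  rewrite expr2 big_distrl; apply: eq_bigr => i _.
  by rewrite big_distrr; apply: eq_bigr => j _; rewrite indicI.
have m2 i : measurable_fun setT (fun w => \sum_(j in S) \1_(D i `&` D j) w : R).
  apply: measurable_sum_cond => j; apply: measurable_indic.
  exact: measurableI.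
have s0 i w : 0 <= \sum_(j in S) \1_(D i `&` D j) w :> R by apply: sumr_ge0.
rewrite ge0_expectationZ ?exprn_ge0//; last 2 first.
- by move=> w; apply: sumr_ge0.
- exact: measurable_sum_cond.
rewrite ge0_expectation_sum//.
apply: (@le_trans _ _ ((#|S|%:R^-1 ^+ 2)%:E *
    \sum_(i in S) (#|S|%:R * (p ^+ 2 + c))%:E)%E).
  rewrite lee_pmul2l ?lte_fin ?exprn_gt0 ?invr_gt0//.
  apply: lee_sum => i iS; apply: le_trans (sum_PDD iS).
  rewrite ge0_expectation_sum//; last first.
    by move=> j; apply: measurable_indic; exact: measurableI.
  by apply: lee_sum => j jS; rewrite expectation_indic//; exact: measurableI.
rewrite sumEFin sumr_const -EFinM lee_fin -mulr_natl le_eqVlt; apply/orP; left.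
by apply/eqP; field; exact: lt0r_neq0.
Qed.

(** The variance of the frequency is the average of the covariances, and
    P (D i `&` D j) - p ^ 2 vanishes unless i and j are dependent. *)
Lemma expectation_frequency_sqr_le :
  ('E_P[fun w => ((frequency w - p) ^+ 2)%R] <= c%:E)%E.
Proof.
(* Expanding the square with all terms on their nonnegative side. *)
have : ('E_P[fun w => ((frequency w - p) ^+ 2)%R] +
  'E_P[fun w => (2 * p * frequency w)%R] =
  'E_P[fun w => (frequency w ^+ 2)%R] + 'E_P[cst (p ^+ 2)%R])%E.
  rewrite -!ge0_expectationD//.
  - by congr expectation; apply/funext => w /=; ring.
  - by move=> w; rewrite sqr_ge0.
  - exact: measurable_funX.
  - by move=> w; rewrite sqr_ge0.
  - by move=> w; rewrite sqr_ge0.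
  - by apply: measurable_funX; apply: measurable_funB.
  - by move=> w; rewrite mulr_ge0// mulr_ge0.
  - exact: measurable_funM.
rewrite ge0_expectationZ// ?mulr_ge0// expectation_frequency expectation_cst.
move=> e; have : (('E_P[fun w => ((frequency w - p) ^+ 2)%R] + (2 * p * p)%:E
    <= (c + p ^+ 2 + p ^+ 2)%:E)%E).
  by rewrite EFinM e [leRHS]EFinD leeD2r// addrC; exact: expectation_frequency2.
by rewrite -leeBrDr// -EFinB; congr (_ <= _%:E)%E; ring.
Qed.

End Frequency.

(** * Labels of an i.i.d. sequence *)

Section IidLabels.
Context {R : realType} {d : measure_display} {Omega : measurableType d}.
Context {P : probability Omega R}.
Context {d' : measure_display} {E : measurableType d'}.
Context {L : finType}.
Variables (X : nat -> {RV P >-> E}) (Y : {RV P >-> E}).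
Variables (lab : E -> L) (mlab : measurable_label lab).

Definition label_word (s : seq nat) (w : Omega) : seq L :=
  [seq lab (X i w) | i <- s].

Lemma measurable_label_rv (Z : {RV P >-> E}) : measurable_label (lab \o Z).
Proof.
move=> a; rewrite comp_preimage -[X in measurable X]setTI.
by apply: measurable_funP => //; exact: mlab.
Qed.

Lemma measurable_label_word s b : measurable [set w | label_word s w = b].
Proof.
elim: s b => [|i s ih] [|a b] /=.
- by rewrite (_ : [set w | _] = setT)//; apply/seteqP; split.
- by rewrite (_ : [set w | _] = set0)//; apply/seteqP; split.
- by rewrite (_ : [set w | _] = set0)//; apply/seteqP; split.
rewrite (_ : [set w | _] =
    (lab \o X i) @^-1` [set a] `&` [set w | label_word s w = b]).
  by apply: measurableI => //; exact: measurable_label_rv.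
by apply/seteqP; split => w /= [-> ->].
Qed.

Hypothesis X_iid : iid_as X Y.

Definition word_weight (b : seq L) : R :=
  \prod_(a <- b) fine (P ((lab \o Y) @^-1` [set a])).

(** The word on s is b when each X_i takes its label at the position of i in s:
    a cylinder event, to which independence applies since s has no repeats. *)
Lemma prob_label_word (s : seq nat) (b : seq L) : uniq s -> size b = size s ->
  P [set w | label_word s w = b] = (word_weight b)%:E.
Proof.
case: X_iid => indep law us sb.
case: b sb => [|a0 b'] sb.
  move/esym/size0nil : sb => ->; rewrite /word_weight big_nil.
  rewrite (_ : [set w | _] = setT) ?probability_setT//.
  by apply/seteqP; split.
set b := a0 :: b' in sb *.
pose A i := lab @^-1` [set nth a0 b (index i s)].
have bE : b = [seq nth a0 b (index i s) | i <- s].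
  apply: (@eq_from_nth _ a0); rewrite ?size_map// => k kb.
  rewrite sb in kb; rewrite (nth_map 0%N)// index_uniq//.
have -> : [set w | label_word s w = b] =
    \bigcap_(i in [set` s]) (X i @^-1` A i).
  apply/seteqP; split => w /=.
    move=> wb i /= si; rewrite /A/= -[in RHS]wb.
    by rewrite (nth_map 0%N) ?index_mem// nth_index.
  by move=> wA; rewrite bE; apply/eq_in_map => i /wA.
rewrite indep//; last by move=> i; exact: mlab.
rewrite /word_weight [in RHS]bE big_map -prodEFin.
apply: eq_bigr => i _; rewrite fineK; last first.
  by apply: fin_num_measure; exact: measurable_label_rv.
exact: law (mlab _).
Qed.

Context {m : nat}.

Definition word_frequency (n : nat) (b : seq L) (w : Omega) : R :=
  'C(n, m)%:R^-1 * \sum_(I : m.-tuple 'I_n | sorted ltn (map val I))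
    \1_[set w | label_word (map val I) w = b] w.

Lemma measurable_word_frequency n b : measurable_fun setT (word_frequency n b).
Proof.
apply: measurable_funM => //; apply: measurable_sum_cond => I.
by apply: measurable_indic; exact: measurable_label_word.
Qed.

(** Weak law of large numbers for U-statistics in its simplest form: distinct
    index tuples that do not meet carry independent words. *)
Lemma word_frequency_sqr_le (n : nat) (b : seq L) :
    (0 < n)%N -> (m <= n)%N -> size b = m ->
  ('E_P[fun w => ((word_frequency n b w - word_weight b) ^+ 2)%R] <=
   (m%:R ^+ 2 / n%:R)%:E)%E.
Proof.
move=> n0 mn bm.
pose S := [set I : m.-tuple 'I_n | sorted ltn (map val I)]%SET.
pose D (I : m.-tuple 'I_n) := [set w | label_word (map val I) w = b].
have cS : #|S| = 'C(n, m) by exact: card_ltn_sorted_tuples.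
have uI (I : m.-tuple 'I_n) : I \in S -> uniq (map val I).
  by rewrite inE; exact: (sorted_uniq ltn_trans ltnn).
rewrite (_ : word_frequency n b = frequency S D); last first.
  apply/funext => w; rewrite /word_frequency /frequency cS; congr (_ * _).
  by apply: eq_bigl => I; rewrite inE.
apply (@expectation_frequency_sqr_le R d Omega P _ S D
  (fun I J => has (mem I) J)).
- by rewrite cS bin_gt0.
- by move=> I; exact: measurable_label_word.
- by move=> I IS; rewrite prob_label_word ?uI// size_map size_tuple.
- move=> I J IS JS IJ.
  rewrite (_ : _ `&` _ =
      [set w | label_word (map val I ++ map val J) w = b ++ b]).
    rewrite prob_label_word ?size_cat ?size_map ?size_tuple ?bm//.
      by rewrite /word_weight big_cat.
    rewrite cat_uniq !uI// andbT/=; apply: contra IJ => /hasP[_ /mapP[j jJ ->]].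
    by rewrite (mem_map val_inj) => jI; apply/hasP; exists j.
  apply/seteqP; split => w /=; rewrite /D/= /label_word map_cat.
    by case=> -> ->.
  move/eqP; rewrite eqseq_cat ?size_map ?size_tuple ?bm//.
  by case/andP => /eqP -> /eqP ->.
- move=> I _; rewrite cS mulrAC ler_pdivlMr ?ltr0n// -natrX -!natrM ler_nat.
  apply: leq_trans (overlapping_sorted_tuples_le I); rewrite leq_mul2r.
  by apply/orP; right; apply/eq_leq/eq_card => J; rewrite !inE.
Qed.

End IidLabels.

(** * Finite quantization of a separable space *)

(** Starting the sequence at 0 makes the quantization error of x at most
    |x|, which is the domination needed for convergence in mean square. *)
Lemma separable_dense_sequence {R : realType} {B : normedModType R} :
  separable B -> exists v : nat -> B,
    v 0%N = 0 /\ forall x e, 0 < e -> exists k, `|x - v k| < e.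
Proof.
case=> D /countable_injP[f f_inj] D_dense.
pose g k := xget 0 [set x | D x /\ f x = k].
exists (fun k => if k is k'.+1 then g k' else 0); split=> // x e e0.
have [||y [xy Dy]] := D_dense (ball x e).
- by exists x; exact: ballxx.
- exact: ball_open.
exists (f y).+1; rewrite (_ : g (f y) = y); first by rewrite -ball_normE in xy.
have [Dg fg] : [set x | D x /\ f x = f y] (g (f y)) by apply: xgetPex; exists y.
by apply: f_inj; rewrite ?inE.
Qed.

Section Quantization.
Context {R : realType} {B : normedModType R}.

Lemma measurable_borel_dist (a : B) :
  measurable_fun setT (fun x : borelType B => `|(x : B) - a|).
Proof.
apply: (measurability _ (RGenOInfty.measurableE R)) => // _ [_ [r ->] <-].
rewrite setTI; apply: sub_sigma_algebra.
rewrite (_ : _ @^-1` _ =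
    (fun x : B => `|x - a|) @^-1` [set y | r < y]); last first.
  by apply/seteqP; split => x /=; rewrite in_itv/= andbT.
apply: open_comp; last exact: open_gt.
by move=> x _; apply: cvg_norm; apply: cvgB; [exact: cvg_id|exact: cvg_cst].
Qed.

Variable v : nat -> B.

(** The recursion keeps the earlier index on ties; each step is one strict
    comparison of distances, so the level sets are Borel by induction. *)
Fixpoint nearest (k : nat) (x : B) : nat :=
  if k is k'.+1 then
    if `|x - v k| < `|x - v (nearest k' x)| then k else nearest k' x
  else 0.

Lemma nearest_le k x : (nearest k x <= k)%N.
Proof. by elim: k => //= k ih; case: ifP => // _; exact: leqW. Qed.

Lemma nearest_dist k x i : (i <= k)%N -> `|x - v (nearest k x)| <= `|x - v i|.
Proof.
elim: k => [|k ih]; first by rewrite leqn0 => /eqP ->.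
rewrite leq_eqVlt => /predU1P[->|] /=; case: ltP => //.
by move=> /ltW kx /ih; exact: le_trans.
Qed.

Lemma measurable_nearest k j :
  measurable [set x : borelType B | nearest k x = j].
Proof.
elim: k j => [|k ih] j /=.
  have [->|j0] := eqVneq j 0%N.
    by rewrite (_ : [set _ | _] = setT)//; apply/seteqP; split.
  rewrite (_ : [set _ | _] = set0)//; apply/seteqP; split => // x /= j0'.
  by rewrite -j0' eqxx in j0.
pose closer i (x : borelType B) := `|(x : B) - v k.+1| < `|(x : B) - v i|.
rewrite (_ : [set _ | _] = \bigcup_(i in `I_k.+1)
    ([set x : borelType B | nearest k x = i] `&`
     closer i @^-1` [set b | (if b then k.+1 else i) = j])).
  apply: fin_bigcup_measurable => // i _; apply: measurableI => //.
  rewrite -[X in measurable X]setTI.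
  by apply: measurable_fun_ltr => //; exact: measurable_borel_dist.
apply/seteqP; split => x /=.
  by move=> e; exists (nearest k x) => //=; rewrite ltnS nearest_le.
by case=> i _ [/= <-].
Qed.

Definition nearest_label (k : nat) (x : borelType B) : 'I_k.+1 :=
  inord (nearest k x).

Lemma nearest_labelK k x : nearest_label k x = nearest k x :> nat.
Proof. by rewrite inordK// ltnS nearest_le. Qed.

Lemma measurable_nearest_label k : measurable_label (nearest_label k).
Proof.
move=> j; rewrite (_ : _ @^-1` _ = [set x : borelType B | nearest k x = j]).
  exact: measurable_nearest.
by apply/seteqP; split => x /= => [<-|e]; [rewrite nearest_labelK|
   apply/val_inj; rewrite /= nearest_labelK].
Qed.

Definition quantize (k : nat) (x : B) : B := v (nearest_label k x).

Hypothesis v0 : v 0%N = 0.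
Hypothesis v_dense : forall x e, 0 < e -> exists k, `|x - v k| < e.

Lemma quantize_dist_le k x : `|x - quantize k x| <= `|x|.
Proof.
rewrite /quantize nearest_labelK; have := nearest_dist x (leq0n k).
by rewrite v0 subr0.
Qed.

Lemma quantize_cvg x : quantize ^~ x @ \oo --> x.
Proof.
apply/cvgrPdist_lt => e e0; have [K xK] := v_dense x e0.
exists K => // k /= Kk; rewrite /quantize nearest_labelK.
exact: le_lt_trans (nearest_dist x Kk) xK.
Qed.

Lemma measurable_quantize_dist k :
  measurable_fun setT (fun x : borelType B => `|(x : B) - quantize k x|).
Proof.
rewrite (_ : (fun _ => _) = fun x : borelType B => \sum_(j < k.+1)
    `|(x : B) - v j| * \1_(nearest_label k @^-1` [set j]) x).
  apply: measurable_sum => j; apply: measurable_funM.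
    exact: measurable_borel_dist.
  by apply: measurable_indic; exact: measurable_nearest_label.
apply/funext => x; rewrite (bigD1 (nearest_label k x))//= indicE mem_set// mulr1.
rewrite big1 ?addr0// => j jx; rewrite indicE memNset ?mulr0//= => e.
by rewrite e eqxx in jx.
Qed.

End Quantization.

(** * Continuity of the squared mean *)

Lemma tensor_norm_elementary_le {R : realType} {B : normedModType R}
    (k : tensor_norm_kind) (x y : B) : tensor_norm k [:: (x, y)] <= `|x| * `|y|.
Proof.
case: k => /=.
  apply: ge_inf; last by exists [:: (x, y)] => //; rewrite big_seq1.
  exists 0 => _ [t _ ->]; apply: sumr_ge0 => p _; exact: mulr_ge0.
apply: ge_sup.
  exists 0; exists (\0 : {scalar B}), (\0 : {scalar B}).
  split => [z|z|]; rewrite ?normr0//.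
  by rewrite big_seq1 /= mul0r normr0.
move=> _ [f [g [fle gle ->]]]; rewrite big_seq1 normrM.
exact: ler_pM.
Qed.

Section SquaredMean.
Context {R : realType} {B T : normedModType R}.
Variable tau : {bilinear B -> B -> T}.
Hypothesis tau_le : forall x y, `|tau x y| <= `|x| * `|y|.

Lemma norm_bilinear_squareB a b :
  `|tau a a - tau b b| <= `|a - b| * (`|a| + `|b|).
Proof.
have -> : tau a a - tau b b = tau (a - b) a + tau b (a - b).
  by rewrite linearBl linearBr addrA subrK.
rewrite (le_trans (ler_normD _ _))// mulrDr lerD//.
by rewrite [leRHS]mulrC tau_le.
Qed.

(** Young's inequality separates the two factors of the difference of squares,
    so that the bound is an average of functions of a single coordinate: its
    expectation depends on the common marginal law only. *)
Lemma norm_squared_meanB (m : nat) (x y : nat -> B) (th : B) (s : seq nat)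
    (e : R) : (0 < m)%N -> size s = m -> 0 < e ->
    (forall i, `|x i - y i| <= `|x i|) ->
  forall a b, a = m%:R^-1 *: (\sum_(i <- s) x i) - th ->
    b = m%:R^-1 *: (\sum_(i <- s) y i) - th ->
  `|tau a a - tau b b| <= m%:R^-1 * \sum_(i <- s)
    (`|x i - y i| ^+ 2 / (2 * e) + e * (9 * `|x i| ^+ 2 + 4 * `|th| ^+ 2)).
Proof.
move=> m0 sm e0 xy a b aE bE.
have mR : 0 < m%:R :> R by rewrite ltr0n.
have m_neq0 : m%:R != 0 :> R by rewrite lt0r_neq0.
have mV : 0 <= m%:R^-1 :> R by rewrite invr_ge0 ltW.
pose dd i := `|x i - y i|; pose g i := 3 * `|x i| + 2 * `|th|.
have sum_cst (c : R) : \sum_(i <- s) c = m%:R * c.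
  by rewrite big_const_seq count_predT sm iter_addr_0 mulr_natl.
have ab_le : `|a - b| <= m%:R^-1 * \sum_(i <- s) dd i.
  rewrite aE bE opprB addrA subrK -scalerBr -sumrB normrZ ger0_norm//.
  by rewrite ler_wpM2l// ler_norm_sum.
have a_b_le : `|a| + `|b| <= m%:R^-1 * \sum_(i <- s) g i.
  have norm_le (z : nat -> B) (h : nat -> R) : (forall i, `|z i| <= h i) ->
      `|m%:R^-1 *: \sum_(i <- s) z i - th| <=
      m%:R^-1 * \sum_(i <- s) h i + `|th|.
    move=> zh; rewrite (le_trans (ler_normB _ _))// lerD2r normrZ ger0_norm//.
    rewrite ler_wpM2l// (le_trans (ler_norm_sum _ _ _))//.
    by apply: ler_sum => i _.
  have y_le i : `|y i| <= 2 * `|x i|.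
    rewrite (_ : y i = x i - (x i - y i)); last by rewrite opprB addrC subrK.
    by rewrite (le_trans (ler_normB _ _))// mulr2n mulrDl mul1r lerD2l.
  have x_le i : `|x i| <= `|x i| by [].
  rewrite aE bE; apply: le_trans (lerD (norm_le x _ x_le) (norm_le y _ y_le)) _.
  rewrite /g big_split/= sum_cst -!mulr_sumr le_eqVlt; apply/orP; left.
  by apply/eqP; field.
apply: le_trans (norm_bilinear_squareB a b) _.
apply: le_trans (ler_pM (normr_ge0 _) (addr_ge0 _ _) ab_le a_b_le) _ => //.
have young i j : dd i * g j <= dd i ^+ 2 / (2 * e) + e / 2 * g j ^+ 2.
  rewrite -subr_ge0 (_ : _ - _ = (dd i - e * g j) ^+ 2 / (2 * e)); last first.
    by field; exact: lt0r_neq0.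
  by rewrite divr_ge0 ?sqr_ge0// mulr_ge0// ltW.
apply: (@le_trans _ _ (m%:R^-1 ^+ 2 * \sum_(i <- s) \sum_(j <- s)
    (dd i ^+ 2 / (2 * e) + e / 2 * g j ^+ 2))).
  rewrite mulrACA -expr2 ler_wpM2l ?exprn_ge0//.
  rewrite big_distrl; apply: ler_sum => i _ /=.
  by rewrite big_distrr; apply: ler_sum => j _ /=.
have -> : m%:R^-1 ^+ 2 * (\sum_(i <- s) \sum_(j <- s)
    (dd i ^+ 2 / (2 * e) + e / 2 * g j ^+ 2)) =
    m%:R^-1 * \sum_(i <- s) (dd i ^+ 2 / (2 * e) + e / 2 * g i ^+ 2).
  under eq_bigr do rewrite big_split/= sum_cst.
  rewrite big_split/= sum_cst [in RHS]big_split/= -mulr_sumr.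
  by field.
rewrite ler_wpM2l//; apply: ler_sum => i _; rewrite lerD2l.
have : 0 <= (3 * `|x i| - 2 * `|th|) ^+ 2 by exact: sqr_ge0.
rewrite mulrAC -mulrA ler_pM2l// /g => h.
by rewrite ler_pdivrMr//; nra.
Qed.

End SquaredMean.

Lemma bilinear_square_cvg {R : realType} {B T : normedModType R}
    (tau : {bilinear B -> B -> T}) (a : B) (b : nat -> B) :
    (forall x y, `|tau x y| <= `|x| * `|y|) -> b @ \oo --> a ->
  tau (b k) (b k) @[k --> \oo] --> tau a a.
Proof.
move=> tau_le ba.
have h : `|a - b k| * (`|a| + `|b k|) @[k --> \oo] --> (0 : R).
  rewrite -[0 : R](mul0r (`|a| + `|a|)); apply: cvgM.
    rewrite -(normr0 B) -(subrr a).
    by apply: cvg_norm; apply: cvgB => //; exact: cvg_cst.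
  by apply: cvgD; [exact: cvg_cst|exact: cvg_norm].
apply/cvgrPdist_le => e e0; move/cvgr0Pnorm_le : h => /(_ e e0).
apply: filterS => k; apply: le_trans.
by rewrite (le_trans (norm_bilinear_squareB tau_le _ _))// ler_norm.
Qed.

(** * Quantization error in mean square *)

Lemma same_law_expectation {R : realType} {d : measure_display}
    {Omega : measurableType d} {P : probability Omega R} {d' : measure_display}
    {E : measurableType d'} (X Y : {RV P >-> E}) (f : E -> R) :
    same_law X Y -> (forall x, 0 <= f x) -> measurable_fun setT f ->
  ('E_P[f \o X] = 'E_P[f \o Y])%E.
Proof.
move=> XY f0 mf; rewrite unlock.
have mf' : measurable_fun setT (EFin \o f) by exact/measurable_EFinP.
have f0' x : (0 <= (EFin \o f) x)%E by rewrite lee_fin.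
rewrite -[LHS](ge0_integral_distribution X mf' f0').
rewrite -[RHS](ge0_integral_distribution Y mf' f0').
by apply: eq_measure_integral => A mA _; exact: XY.
Qed.

Section QuantizationError.
Context {R : realType} {d : measure_display} {Omega : measurableType d}.
Context {P : probability Omega R} {B : normedModType R}.
Variables (X : {RV P >-> borelType B}) (v : nat -> B).
Hypothesis X_sq : ('E_P[fun w => (`|(X w : B)| ^+ 2)%R] < +oo)%E.
Hypothesis v0 : v 0%N = 0.
Hypothesis v_dense : forall x e, 0 < e -> exists k, `|x - v k| < e.

Let mnorm : measurable_fun setT (fun x : borelType B => `|x : B|).
Proof.
rewrite (_ : (fun _ => _) = fun x : borelType B => `|(x : B) - 0|).
  exact: measurable_borel_dist.
by apply/funext => x; rewrite subr0.
Qed.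

Lemma quantize_mean_square_cvg :
  'E_P[fun w => (`|(X w : B) - quantize v k (X w)| ^+ 2)%R]%E @[k --> \oo]
    --> 0%E.
Proof.
rewrite unlock.
have mX2 : measurable_fun setT (fun w => `|X w : B| ^+ 2).
  by apply: measurable_funX; exact: measurableT_comp mnorm _.
have [||||| _ _] := @dominated_convergence _ _ _ P _ measurableT
  (fun k w => (`|(X w : B) - quantize v k (X w)| ^+ 2)%:E) (cst 0%E)
  (fun w => (`|X w : B| ^+ 2)%:E).
- move=> k; apply/measurable_EFinP; apply: measurable_funX.
  exact: measurableT_comp (measurable_quantize_dist v k) _.
- exact: measurable_cst.
- apply/aeW => w _; apply/fine_cvgP; split; first exact: nearW.
  have h : `|(X w : B) - quantize v k (X w)| @[k --> \oo] --> (0 : R).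
    rewrite -(normr0 B) -(subrr (X w : B)); apply: cvg_norm; apply: cvgB.
      exact: cvg_cst.
    exact: quantize_cvg.
  rewrite -[0 : R](mul0r 0); exact: (cvgM h h).
- apply/integrableP; split; first exact/measurable_EFinP.
  apply: le_lt_trans X_sq; rewrite unlock le_eqVlt; apply/orP; left; apply/eqP.
  by apply: eq_integral => w _; rewrite gee0_abs// lee_fin sqr_ge0.
- apply/aeW => w k _; rewrite gee0_abs ?lee_fin ?sqr_ge0//.
  by rewrite lerXn2r ?nnegrE//; exact: quantize_dist_le.
by rewrite integral0.
Qed.

(** The two summands come from Young's inequality: the quantization error, made
    small by refining the quantization, and a second moment, made small by the
    free parameter e. *)
Definition quantization_bound (th : B) (e : R) (k : nat) (x : borelType B) :=
  `|(x : B) - quantize v k x| ^+ 2 / (2 * e) +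
  e * (9 * `|x : B| ^+ 2 + 4 * `|th| ^+ 2).

Lemma quantization_bound_ge0 th e k x : 0 < e ->
  0 <= quantization_bound th e k x.
Proof.
move=> e0; apply: addr_ge0; first by rewrite divr_ge0 ?sqr_ge0// mulr_ge0// ltW.
by apply: mulr_ge0; [exact: ltW|rewrite addr_ge0// mulr_ge0// sqr_ge0].
Qed.

Lemma measurable_quantization_bound th e k :
  measurable_fun setT (quantization_bound th e k).
Proof.
apply: measurable_funD.
  apply: measurable_funM => //; apply: measurable_funX.
  exact: measurable_quantize_dist.
apply: measurable_funM => //; apply: measurable_funD => //.
by apply: measurable_funM => //; exact: measurable_funX.
Qed.

Lemma quantization_bound_small th eta : 0 < eta -> exists2 e, 0 < e &
  \forall k \near \oo, ('E_P[quantization_bound th e k \o X] <= eta%:E)%E.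
Proof.
move=> eta0.
pose Q := fine 'E_P[fun w => (`|(X w : B)| ^+ 2)%R].
have QE : ('E_P[fun w => (`|(X w : B)| ^+ 2)%R] = Q%:E)%E.
  by rewrite /Q fineK// ge0_fin_numE// expectation_ge0// => w; rewrite sqr_ge0.
have Q0 : 0 <= Q.
  by rewrite -lee_fin -QE expectation_ge0// => w; rewrite sqr_ge0.
pose K := 9 * Q + 4 * `|th| ^+ 2.
have K0 : 0 <= K by rewrite addr_ge0// mulr_ge0// sqr_ge0.
pose e := eta / (2 * (K + 1)).
have e0 : 0 < e by rewrite divr_gt0// mulr_gt0// ltr_wpDl.
exists e => //.
have md k : measurable_fun setT
    (fun w => `|(X w : B) - quantize v k (X w)| ^+ 2).
  apply: measurable_funX.
  exact: measurableT_comp (measurable_quantize_dist v k) _.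
have mXX : measurable_fun setT (fun w => `|(X w : B)| ^+ 2).
  by apply: measurable_funX; exact: measurableT_comp mnorm _.
have E2 : ('E_P[fun w => (e * (9 * `|(X w : B)| ^+ 2 + 4 * `|th| ^+ 2))%R] =
    (e * K)%:E)%E.
  have m9 : measurable_fun setT (fun w => 9 * `|(X w : B)| ^+ 2 : R).
    exact: measurable_funM.
  rewrite ge0_expectationZ ?(ltW e0)//; last exact: measurable_funD.
  rewrite ge0_expectationD// ge0_expectationZ//.
  by rewrite QE (expectation_cst P (4 * `|th| ^+ 2)).
have /ge0_cvge0P := quantize_mean_square_cvg.
move=> /(_ _ (eta * e)) h.
have := h (fun k => expectation_ge0 _ (fun w => sqr_ge0 _)) (mulr_gt0 eta0 e0).
apply: filterS => k hk.
rewrite /quantization_bound [X in ('E_P[X])%E](_ : _ = fun w =>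
  (2 * e)^-1 * (`|(X w : B) - quantize v k (X w)| ^+ 2) +
  e * (9 * `|(X w : B)| ^+ 2 + 4 * `|th| ^+ 2)); last first.
  by apply/funext => w /=; rewrite [_ / (2 * e)]mulrC.
have e2 : 0 <= (2 * e)^-1 by rewrite invr_ge0 mulr_ge0// ltW.
rewrite ge0_expectationD//; last 4 first.
- by move=> w; rewrite mulr_ge0// sqr_ge0.
- exact: measurable_funM.
- by move=> w; rewrite mulr_ge0 ?(ltW e0)// addr_ge0// mulr_ge0// sqr_ge0.
- apply: measurable_funM => //; apply: measurable_funD => //.
  exact: measurable_funM.
rewrite E2 ge0_expectationZ//.
apply: le_trans (leeD2r _ (lee_wpmul2l _ hk)) _; first by rewrite lee_fin.
rewrite -EFinM -EFinD lee_fin.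
rewrite (_ : (2 * e)^-1 * (eta * e) = eta / 2); last by field; exact: lt0r_neq0.
rewrite (_ : e * K = (eta / 2) * (K / (K + 1))); last first.
  by rewrite /e; field; apply: lt0r_neq0; exact: ltr_wpDl.
have : K / (K + 1) <= 1 by rewrite ler_pdivrMr ?ltr_wpDl// mul1r lerDl.
nra.
Qed.

End QuantizationError.

(** * Convergence of the sample covariance *)

Lemma expectation_average_le {R : realType} {d : measure_display}
    {Omega : measurableType d} (P : probability Omega R) (I : Type)
    (s : seq I) (Q : pred I) (c eta : R) (f : I -> Omega -> R) :
    0 <= c -> c * (count Q s)%:R <= 1 -> 0 <= eta ->
    (forall i w, 0 <= f i w) -> (forall i, measurable_fun setT (f i)) ->
    (forall i, ('E_P[f i] <= eta%:E)%E) ->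
  ('E_P[fun w => (c * \sum_(i <- s | Q i) f i w)%R] <= eta%:E)%E.
Proof.
move=> c0 cQ eta0 f0 mf fE.
rewrite ge0_expectationZ//; last 2 first.
- by move=> w; apply: sumr_ge0.
- exact: measurable_sum_cond.
rewrite ge0_expectation_sum//.
apply: (@le_trans _ _ (c%:E * \sum_(i <- s | Q i) eta%:E)%E).
  by rewrite lee_wpmul2l ?lee_fin//; apply: lee_sum.
rewrite sumEFin -EFinM lee_fin big_const_seq iter_addr_0 -mulr_natl mulrA.
by rewrite ler_piMl.
Qed.

Section SampleCovariance.
Context {R : realType} {d : measure_display} {Omega : measurableType d}.
Context {P : probability Omega R} {B : normedModType R}.
Context {T : completeNormedModType R}.
Variable tau : {bilinear B -> B -> T}.
Hypothesis tau_le : forall x y, `|tau x y| <= `|x| * `|y|.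
Variables (Xs : nat -> {RV P >-> borelType B}) (X : {RV P >-> borelType B}).
Hypothesis Xs_iid : iid_as Xs X.
Variables (m : nat) (m_gt0 : (0 < m)%N).
Hypothesis X_sq : ('E_P[fun w => (`|(X w : B)| ^+ 2)%R] < +oo)%E.
Variable v : nat -> B.
Hypothesis v0 : v 0%N = 0.
Hypothesis v_dense : forall x e, 0 < e -> exists k, `|x - v k| < e.

Local Notation th := (theta m Xs).
Local Notation word k := (label_word Xs (nearest_label v k)).
Local Notation freq k :=
  (@word_frequency _ _ _ _ _ _ _ Xs (nearest_label v k) m).
Local Notation weight k := (word_weight X (nearest_label v k)).
Local Notation bound e k i w := (quantization_bound v th e k (Xs i w)).

(** Value of the kernel when every argument is replaced by its quantization. *)
Definition quantized_square (k : nat) (b : seq 'I_k.+1) : T :=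
  let a := m%:R^-1 *: (\sum_(j <- b) v j) - th in tau a a.

Lemma centered_square_quantized_le e k s w : 0 < e -> size s = m ->
  `|centered_square m Xs tau s w - quantized_square (word k s w)| <=
  m%:R^-1 * \sum_(i <- s) bound e k i w.
Proof.
move=> e0 sm; apply: (norm_squared_meanB tau_le (x := fun i => Xs i w)
  (y := fun i => quantize v k (Xs i w)) m_gt0 sm e0) => //.
- by move=> i; exact: quantize_dist_le.
- by rewrite big_map.
Qed.

Lemma expectation_bound_le e k eta (i : nat) : 0 < e ->
    ('E_P[quantization_bound v th e k \o X] <= eta%:E)%E ->
  ('E_P[fun w => bound e k i w] <= eta%:E)%E.
Proof.
move=> e0; apply: le_trans; rewrite le_eqVlt; apply/orP; left; apply/eqP.
case: Xs_iid => _ law; apply: (same_law_expectation (law i)).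
  by move=> x; exact: quantization_bound_ge0.
exact: measurable_quantization_bound.
Qed.

Let bound_ge0 e k i w : 0 < e -> 0 <= bound e k i w.
Proof. exact: quantization_bound_ge0. Qed.

Let measurable_bound e k i : measurable_fun setT (fun w => bound e k i w).
Proof. exact: measurableT_comp (measurable_quantization_bound v th e k) _. Qed.

Lemma expectation_mean_bound_le e k eta s : 0 < e -> size s = m -> 0 <= eta ->
    ('E_P[quantization_bound v th e k \o X] <= eta%:E)%E ->
  ('E_P[fun w => (m%:R^-1 * \sum_(i <- s) bound e k i w)%R] <= eta%:E)%E.
Proof.
move=> e0 sm eta0 kE; apply: expectation_average_le => //.
- by rewrite count_predT sm mulVf// pnatr_eq0 -lt0n.
- by move=> i w; exact: bound_ge0.
- by move=> i; exact: expectation_bound_le kE.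
Qed.

Let quantized_label k w : m.-tuple 'I_k.+1 :=
  [tuple of [seq nearest_label v k (Xs i w) | i <- iota_tuple m 0]].

Let quantized_labelE k w : quantized_label k w = word k (iota 0 m) w :> seq _.
Proof. by []. Qed.

Let quantized_label_preimage k (b : m.-tuple 'I_k.+1) :
  quantized_label k @^-1` [set b] = [set w | word k (iota 0 m) w = b].
Proof. by apply/seteqP; split => w /= => [<-//|e]; exact/val_inj. Qed.

Let measurable_quantized_label k : measurable_label (quantized_label k).
Proof.
move=> b; rewrite quantized_label_preimage.
by apply: measurable_label_word; exact: measurable_nearest_label.
Qed.

Let quantized_mean k :=
  \sum_(b : m.-tuple 'I_k.+1) weight k b *: quantized_square b.

(** The quantized kernels form a Bochner approximation of the kernel. *)
Lemma norm_cov_quantizedB e k eta : 0 < e -> 0 <= eta ->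
    ('E_P[quantization_bound v th e k \o X] <= eta%:E)%E ->
  `|cov m Xs tau - quantized_mean k| <= eta.
Proof.
move=> e0 eta0 kE; rewrite -lee_fin.
pose t l w := quantized_square (quantized_label l w).
have ft_le e' l eta' : 0 < e' -> 0 <= eta' ->
    ('E_P[quantization_bound v th e' l \o X] <= eta'%:E)%E ->
    ('E_P[fun w => `|centered_square m Xs tau (iota 0 m) w - t l w|%R] <=
     eta'%:E)%E.
  move=> e'0 eta'0 lE.
  apply: le_trans (expectation_mean_bound_le e'0 (size_iota 0 m) eta'0 lE).
  apply: ge0_expectation_mono => // w.
  by rewrite /t quantized_labelE centered_square_quantized_le// size_iota.
have tE l : t l = (fun b : m.-tuple 'I_l.+1 => quantized_square b) \o
    quantized_label l by [].
have t_simple l : simple_function (t l).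
  by rewrite tE; apply: simple_function_label.
have t_mean l : simple_expectation P (t l) = quantized_mean l.
  rewrite tE (simple_expectation_label P (@measurable_quantized_label l)).
  apply: eq_bigr => b _; congr (_ *: _).
  rewrite quantized_label_preimage.
  rewrite (prob_label_word (@measurable_nearest_label _ _ v l) Xs_iid).
  - by [].
  - exact: iota_uniq.
  by rewrite size_tuple size_iota.
rewrite -t_mean; apply: le_trans (ft_le _ _ _ e0 eta0 kE).
apply: norm_bochner_expectationB => //.
- move=> w; apply: bilinear_square_cvg => //; apply: cvgB; last exact: cvg_cst.
  apply: cvgZr; rewrite -[iota 0 m]/(val (iota_tuple m 0)).
  under eq_cvg do rewrite big_map.
  apply: cvg_big => [|i _]; first exact: add_continuous.
  exact: quantize_cvg.
- apply/ge0_cvge0P => [l|eta' eta'0]; first exact: expectation_ge0.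
  have [e' e'0] := quantization_bound_small X_sq v0 v_dense th eta'0.
  by apply: filterS => l; apply: ft_le => //; exact: ltW.
Qed.

Let word_tuple k n (I : m.-tuple 'I_n) w : m.-tuple 'I_k.+1 :=
  [tuple of [seq nearest_label v k (Xs i w) | i <- map_tuple val I]].

Let sum_quantized_square k n w :
  'C(n, m)%:R^-1 *: \sum_(I : m.-tuple 'I_n | sorted ltn (map val I))
    quantized_square (word k (map val I) w) =
  \sum_(b : m.-tuple 'I_k.+1) freq k n b w *: quantized_square b.
Proof.
rewrite scaler_sumr.
under [RHS]eq_bigr do rewrite -scalerA scaler_suml scaler_sumr.
rewrite [RHS]exchange_big/=; apply: eq_bigr => I _.
rewrite (bigD1 (word_tuple k I w))//= indicE mem_set// scale1r big1 ?addr0//.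
move=> b bI; rewrite indicE memNset ?scale0r ?scaler0//= => e.
by case/eqP: bI; apply/val_inj.
Qed.

(** The error splits into the quantization error of the sample, the fluctuation
    of the word frequencies, and the quantization error of the covariance.  The
    parameter c trades the mean of a fluctuation for its mean square. *)
Lemma expectation_sample_cov_le e k eta c n : 0 < e -> 0 <= eta -> 0 < c ->
    (m <= n)%N -> ('E_P[quantization_bound v th e k \o X] <= eta%:E)%E ->
  ('E_P[fun w => `|sample_cov m Xs tau n w - cov m Xs tau|%R] <=
   (2 * eta + (\sum_(b : m.-tuple 'I_k.+1) `|quantized_square b|) *
     (c / 2 + m%:R ^+ 2 / n%:R / (2 * c)))%:E)%E.
Proof.
move=> e0 eta0 c0 mn kE.
have n0 : (0 < n)%N by exact: leq_trans mn.
have C0 : 0 < 'C(n, m)%:R :> R by rewrite ltr0n bin_gt0.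
pose F b w := freq k n b w - weight k b.
pose A w := 'C(n, m)%:R^-1 * \sum_(I : m.-tuple 'I_n | sorted ltn (map val I))
  (m%:R^-1 * \sum_(i <- map val I) bound e k i w).
pose G w := \sum_(b : m.-tuple 'I_k.+1) `|quantized_square b| *
  (c / 2 + (2 * c)^-1 * F b w ^+ 2).
have c2 : 0 <= (2 * c)^-1 by rewrite invr_ge0 mulr_ge0// ltW.
have young z : `|z| <= c / 2 + (2 * c)^-1 * z ^+ 2.
  rewrite -subr_ge0 (_ : _ - _ = (2 * c)^-1 * (`|z| - c) ^+ 2).
    by rewrite mulr_ge0// sqr_ge0.
  by rewrite -(real_normK (num_real z)); field; exact: lt0r_neq0.
have le_AG w : `|sample_cov m Xs tau n w - cov m Xs tau| <= A w + G w + eta.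
  have -> : sample_cov m Xs tau n w - cov m Xs tau =
      'C(n, m)%:R^-1 *: (\sum_(I : m.-tuple 'I_n | sorted ltn (map val I))
        (centered_square m Xs tau (map val I) w -
         quantized_square (word k (map val I) w))) +
      \sum_(b : m.-tuple 'I_k.+1) F b w *: quantized_square b +
      (quantized_mean k - cov m Xs tau).
    rewrite sumrB scalerBr sum_quantized_square.
    under [X in _ + X + _]eq_bigr do rewrite scalerBl.
    by rewrite sumrB [X in _ = X + _]addrA subrK addrA subrK.
  rewrite (le_trans (ler_normD _ _))// lerD//; last first.
    by rewrite distrC (norm_cov_quantizedB e0).
  rewrite (le_trans (ler_normD _ _))// lerD//.
    rewrite normrZ ger0_norm ?invr_ge0// ler_wpM2l ?invr_ge0//.
    rewrite (le_trans (ler_norm_sum _ _ _))//; apply: ler_sum => I _.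
    by rewrite centered_square_quantized_le// size_map size_tuple.
  rewrite (le_trans (ler_norm_sum _ _ _))//; apply: ler_sum => b _.
  by rewrite normrZ mulrC ler_wpM2l.
have A0 w : 0 <= A w.
  rewrite mulr_ge0 ?invr_ge0// sumr_ge0// => I _.
  by rewrite mulr_ge0 ?invr_ge0// sumr_ge0// => i _; exact: bound_ge0.
have mF b : measurable_fun setT (F b).
  apply: measurable_funB => //; apply: measurable_word_frequency.
  exact: measurable_nearest_label.
have F2_ge0 b w : 0 <= (2 * c)^-1 * F b w ^+ 2 by rewrite mulr_ge0// sqr_ge0.
have mF2 b : measurable_fun setT (fun w => (2 * c)^-1 * F b w ^+ 2).
  by apply: measurable_funM => //; exact: measurable_funX.
have cF_ge0 b w : 0 <= c / 2 + (2 * c)^-1 * F b w ^+ 2.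
  by rewrite addr_ge0// divr_ge0// ltW.
have mcF b : measurable_fun setT (fun w => c / 2 + (2 * c)^-1 * F b w ^+ 2).
  exact: measurable_funD.
have G0 w : 0 <= G w by apply: sumr_ge0 => b _; rewrite mulr_ge0.
have mean_bound_ge0 (I : m.-tuple 'I_n) w :
    0 <= m%:R^-1 * \sum_(i <- map val I) bound e k i w.
  by rewrite mulr_ge0 ?invr_ge0// sumr_ge0// => i _; exact: bound_ge0.
have mmean_bound (I : m.-tuple 'I_n) : measurable_fun setT
    (fun w => m%:R^-1 * \sum_(i <- map val I) bound e k i w).
  by apply: measurable_funM => //; apply: measurable_sum_cond.
have mA : measurable_fun setT A.
  by apply: measurable_funM => //; apply: measurable_sum_cond.
have mG : measurable_fun setT G.
  by apply: measurable_sum => b; apply: measurable_funM.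
have EA : ('E_P[A] <= eta%:E)%E.
  apply: expectation_average_le => //.
  - by rewrite -sum1_count sum1dep_card card_ltn_sorted_tuples mulVf ?lt0r_neq0.
  - by move=> I; apply: expectation_mean_bound_le; rewrite ?size_map ?size_tuple.
have EG : ('E_P[G] <= ((\sum_(b : m.-tuple 'I_k.+1) `|quantized_square b|) *
     (c / 2 + m%:R ^+ 2 / n%:R / (2 * c)))%:E)%E.
  rewrite ge0_expectation_sum//; last 2 first.
  - by move=> b w; rewrite mulr_ge0.
  - by move=> b; exact: measurable_funM.
  rewrite mulr_suml -sumEFin; apply: lee_sum => b _.
  rewrite ge0_expectationZ// EFinM lee_wpmul2l ?lee_fin//.
  rewrite (ge0_expectationD P (f := cst (c / 2))
    (g := fun w => (2 * c)^-1 * F b w ^+ 2))//; last first.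
    by move=> w; rewrite divr_ge0// ltW.
  rewrite expectation_cst EFinD leeD2l// ge0_expectationZ//; last 2 first.
  - by move=> w; exact: sqr_ge0.
  - exact: measurable_funX.
  rewrite [_ / (2 * c)]mulrC EFinM lee_wpmul2l ?lee_fin//.
  apply: word_frequency_sqr_le => //; last by rewrite size_tuple.
  exact: measurable_nearest_label.
apply: le_trans (ge0_expectation_mono _ _ le_AG) _ => //.
rewrite (ge0_expectationD P (f := fun w => A w + G w) (g := cst eta))//.
- rewrite ge0_expectationD// expectation_cst.
  apply: le_trans (leeD2r _ (leeD EA EG)) _.
  by rewrite -!EFinD lee_fin; lra.
- by move=> w; rewrite addr_ge0.
- exact: measurable_funD.
Qed.

Lemma sample_cov_cvg :
  'E_P[fun w => `|sample_cov m Xs tau n w - cov m Xs tau|%R]%E @[n --> \oo]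
    --> 0%E.
Proof.
apply/ge0_cvge0P => [n|eta eta0]; first exact: expectation_ge0.
(* e and k make both quantization errors at most eta / 4, then c, then n make
   the two parts of the fluctuation term at most eta / 4. *)
have eta4 : 0 < eta / 4 by rewrite divr_gt0.
have [e e0 small] := quantization_bound_small X_sq v0 v_dense th eta4.
have [k kE] := filter_ex small.
pose g := \sum_(b : m.-tuple 'I_k.+1) `|quantized_square b|.
have g0 : 0 <= g by apply: sumr_ge0.
pose c := eta / (2 * (g + 1)).
have c0 : 0 < c by rewrite divr_gt0// mulr_gt0// ltr_wpDl.
have gc : g * (c / 2) <= eta / 4.
  rewrite (_ : g * (c / 2) = eta / 4 * (g / (g + 1))); last first.
    by rewrite /c; field; apply: lt0r_neq0; exact: ltr_wpDl.
  by rewrite ler_piMr ?(ltW eta4)// ler_pdivrMr ?ltr_wpDl// mul1r lerDl.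
pose K := g * m%:R ^+ 2 / (2 * c) / (eta / 4).
near=> n.
apply: le_trans (expectation_sample_cov_le e0 (ltW eta4) c0 _ kE) _.
  by near: n; exists m.
have n0 : 0 < n%:R :> R.
  by near: n; exists 1%N => // j; rewrite ltr0n.
have Kn : K <= n%:R.
  near: n; exact: nbhs_infty_ger.
have gm : g * (m%:R ^+ 2 / n%:R / (2 * c)) <= eta / 4.
  rewrite (_ : _ * _ = g * m%:R ^+ 2 / (2 * c) / n%:R); last first.
    by field; rewrite !lt0r_neq0.
  by rewrite ler_pdivrMr// [leRHS]mulrC -ler_pdivrMr.
rewrite lee_fin -/g mulrDr; lra.
Unshelve. all: by end_near. Qed.

End SampleCovariance.

Theorem theorem3p1 (R : realType) (d : measure_display)
    (Omega : measurableType d) (P : probability Omega R)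
    (B : completeNormedModType R) (B_separable : separable B)
    (k : tensor_norm_kind) (T : completeNormedModType R)
    (tau : {bilinear B -> B -> T})
    (T_tensor : is_completed_tensor_product k tau)
    (Xs : nat -> {RV P >-> borelType B}) (X : {RV P >-> borelType B})
    (Xs_iid : iid_as Xs X)
    (m : nat) (m_ge1 : (1 <= m)%N)
    (X_sq : ('E_P[fun w => (`|(X w : B)| ^+ 2)%R] < +oo)%E) :
  'E_P[fun w => `|sample_cov m Xs tau n w - cov m Xs tau|%R]%E @[n --> \oo] --> 0%E.
Proof.
have tau_le x y : `|tau x y| <= `|x| * `|y|.
  case: T_tensor => /(_ [:: (x, y)]) + _; rewrite big_seq1 => ->.
  exact: tensor_norm_elementary_le.
have [v [v0 v_dense]] := separable_dense_sequence B_separable.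
exact: (sample_cov_cvg tau_le Xs_iid m_ge1 X_sq v0 v_dense).
Qed.
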